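(* For $n\ge2$ let $X^{(n)}$ be a random variable with values in $\{1,\dots,n+1\}$ and $\mathbb P(X^{(n)}=j)=\mathcal T^{(1)}_{n,j}$ for $1\le j\le n+1$. Then for every $n\ge2$, $$\mathbb E[X^{(n)}]=n-\frac74+\frac{3n+1}{2^n},\qquad \mathbb E[(X^{(n)})^2]=n^2-\frac{7n}{2}+\frac{27}{4}+\frac{n^2+6n-13}{2^n},$$ and $$\operatorname{Var}[X^{(n)}]=\frac{59}{16}-\frac{10n^2-29n+19}{2^{n+1}}-\frac{9n^2+6n+1}{4^n}.$$
   Context: Define $\psi:\{1,2,3,\dots\}\to\{0,1,2,\dots\}$ by $\psi(1)=0$, $\psi(2)=1$, $\psi(3)=2$ and $\psi(j)=\sum_{k=1}^{j-1}\psi(k)$ for $j\ge 4$. The triangular array $\mathcal T=(\mathcal T_{n,j})$, $n\ge 0$, $1\le j\le n+1$, of integers is defined recursively by: $\mathcal T_{n,n+1}=1$ for every $n\ge 0$; $\mathcal T_{1,1}=1$, $\mathcal T_{2,2}=2$, $\mathcal T_{3,3}=3$; $\mathcal T_{n,n}=\sum_{k=1}^{n-2}\mathcal T_{n-k,n-k}$ for every $n\ge 4$; and $\mathcal T_{n,j}=\mathcal T_{n-1,j}+\psi(j)$ for every $n\ge 2$ and $1\le j\le n-1$. The normalised array is $\mathcal T^{(1)}_{n,j}=2^{-n}\mathcal T_{n,j}$; each of its rows is a probability mass function. *)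

(* Defs.v *)
From HB Require Import structures.
From mathcomp Require Import all_boot all_order all_algebra.
From mathcomp Require Import all_classical all_reals all_analysis.

Set Implicit Arguments.
Unset Strict Implicit.
Unset Printing Implicit Defensive.

Import Order.TTheory GRing.Theory Num.Theory.

Local Open Scope ring_scope.

(* [:: psi 1; ...; psi n]; course-of-values recursion on the prefix. *)
Fixpoint psi_seq (n : nat) : seq nat :=
  if n is m.+1 then
    let s := psi_seq m in
    rcons s (match m with 0 => 0 | 1 => 1 | 2 => 2 | _ => sumn s end)%N
  else [::].

(* The value psi 0 = 0 is junk. *)
Definition psi (j : nat) : nat := nth 0%N (psi_seq j) j.-1.

(* [:: T_{1,1}; ...; T_{n,n}]; behead drops T_{1,1}, which is not a term of
   the sum \sum_(1 <= k <= n-2) T_{n-k,n-k}. *)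
Fixpoint diag_seq (n : nat) : seq int :=
  if n is m.+1 then
    let s := diag_seq m in
    rcons s (match m with
             | 0 => 1 | 1 => 2 | 2 => 3 | _ => \sum_(x <- behead s) x
             end)
  else [::].

(* The entries with j = 0 or j > n + 1 are junk (equal to 0). *)
Fixpoint Tarr (n j : nat) : int :=
  if j == n.+1 then 1
  else if n is m.+1 then
    if j == m.+1 then (diag_seq m.+1)`_m
    else if (j < m.+1)%N then Tarr m j + (psi j)%:Z
    else 0
  else 0.

Definition Tnorm (R : realType) (n j : nat) : R := 2 ^- n * (Tarr n j)%:~R.

Lemma size_psi_seq n : size (psi_seq n) = n.
Proof. by elim: n => //= n IH; rewrite size_rcons IH. Qed.

Lemma psi_seqE n : psi_seq n = [seq psi j | j <- iota 1 n].
Proof.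
elim: n => // n IH.
rewrite -addn1 iotaD map_cat -IH add1n /= addn1 cats1 /=; congr rcons.
by rewrite /psi /= nth_rcons size_psi_seq ltnn eqxx.
Qed.

Lemma psi1 : psi 1 = 0%N. Proof. by []. Qed.
Lemma psi2 : psi 2 = 1%N. Proof. by []. Qed.
Lemma psi3 : psi 3 = 2%N. Proof. by []. Qed.

Lemma psi_rec j : (4 <= j)%N -> psi j = (\sum_(1 <= k < j) psi k)%N.
Proof.
case: j => [|[|[|[|j]]]] // _.
have -> : psi j.+4 = sumn (psi_seq j.+3).
  rewrite {1}/psi [psi_seq j.+4]/= -/(psi_seq j.+3) nth_rcons.
  by rewrite (size_psi_seq j.+3) ltnn eqxx.
by rewrite psi_seqE sumnE big_map /index_iota subSS subn0.
Qed.

Lemma Tarr_last n : Tarr n n.+1 = 1.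
Proof. by case: n => [//|n]; rewrite [LHS]/= eqxx. Qed.

Lemma size_diag_seq n : size (diag_seq n) = n.
Proof. by elim: n => //= n IH; rewrite size_rcons IH. Qed.

Lemma Tarr_diagE n : Tarr n.+1 n.+1 = (diag_seq n.+1)`_n.
Proof. by rewrite [LHS]/= ltn_eqF // eqxx. Qed.

Lemma diag_seqE n : diag_seq n = [seq Tarr m m | m <- iota 1 n].
Proof.
elim: n => // n IH.
have -> : iota 1 n.+1 = rcons (iota 1 n) n.+1 
  by rewrite -{1}(addn1 n) iotaD add1n cats1.
rewrite map_rcons -IH Tarr_diagE [diag_seq n.+1]/= nth_rcons.
by rewrite size_diag_seq ltnn eqxx.
Qed.

Lemma Tarr11 : Tarr 1 1 = 1. Proof. by []. Qed.
Lemma Tarr22 : Tarr 2 2 = 2. Proof. by []. Qed.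
Lemma Tarr33 : Tarr 3 3 = 3. Proof. by []. Qed.

Lemma Tarr_diag n : (4 <= n)%N ->
  Tarr n n = \sum_(1 <= k < n.-1) Tarr (n - k) (n - k).
Proof.
case: n => [|[|[|[|n]]]] // _.
have -> : Tarr n.+4 n.+4 = \sum_(x <- behead (diag_seq n.+3)) x.
  rewrite Tarr_diagE [diag_seq n.+4]/= -/(diag_seq n.+3) nth_rcons.
  by rewrite (size_diag_seq n.+3) ltnn eqxx.
have -> : behead (diag_seq n.+3) = [seq Tarr m m | m <- index_iota 2 n.+4].
  by rewrite diag_seqE.
rewrite big_map big_nat_rev /= [LHS]big_add1 /=.
by apply: eq_big_nat => k _; congr (Tarr _ _); rewrite !addSn add0n !subSS.
Qed.

Lemma Tarr_rec n j : (2 <= n)%N -> (1 <= j <= n.-1)%N ->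
  Tarr n j = Tarr n.-1 j + (psi j)%:Z.
Proof.
case: n => // n _ /andP[_ /= jn].
by rewrite !ltn_eqF ?ltnS ?(leq_trans jn) // jn.
Qed.

(* Main.v *)
Require Import Defs.
From HB Require Import structures.
From mathcomp Require Import all_boot all_order all_algebra.
From mathcomp Require Import all_classical all_reals all_analysis.
From mathcomp Require Import ring zify.

Import Order.TTheory GRing.Theory Num.Theory.

Local Open Scope classical_set_scope.
Local Open Scope ring_scope.

(** A random variable with finitely many values turns every moment into a
finite weighted sum over the law ([expectation_finite_support] and
[variance_finite_support]), so the three formulas are statements about the row
sums of [f j * T_(n,j)] for [f j = 1, j, j ^ 2].

These sums obey a recurrence in [n]: row [n + 1] is row [n] with [psi j] added
to the entries [j <= n], with its entry [j = n + 1] changed from [1] to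
[T_(n+1,n+1)], and with a new entry [1] at the end ([weighted_row_sum_rec]).
Both ingredients are geometric from index 4 on, because there each term is the
sum of the previous ones ([T_(1,1)] left out): [psi (n + 4) = 3 * 2 ^ n] and [T_(n+4,n+4) = 5 * 2 ^ n].  Hence
the partial sums of [psi j], [j * psi j], [j ^ 2 * psi j] have closed forms
([psi_moments]), and then so have the moments of the rows ([row_moments]), by
induction starting at [n = 3]. *)

(* Their unfolded forms are large; all computations go through the recurrences. *)
Arguments Tarr : simpl never.
Arguments psi : simpl never.

(** * Closed forms of the ingredients *)

Lemma psi_geom n : psi n.+4 = (3 * 2 ^ n)%N.
Proof.
elim: n => [|n IHn].
  by rewrite psi_rec // /index_iota /= unlock.
(* All terms of the sum but the last add up to the last one. *)
rewrite psi_rec // big_nat_recr //= -psi_rec // IHn addnn -mul2n expnS.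
by rewrite mulnCA.
Qed.

Lemma Tarr_diag_geom n : Tarr n.+4 n.+4 = 5 * 2 ^+ n.
Proof.
have diag_sum m : (4 <= m)%N -> Tarr m m = \sum_(2 <= k < m) Tarr k k.
  move=> m_ge4; rewrite Tarr_diag // big_nat_rev /= [RHS]big_add1.
  by apply: eq_big_nat => k /andP[_ km]; congr (Tarr _ _); lia.
elim: n => [|n IHn].
  by rewrite diag_sum // /index_iota /= unlock.
rewrite diag_sum // big_nat_recr //= -diag_sum // IHn exprS; ring.
Qed.

Lemma exp2_add3 (R : comPzRingType) m :
  2 ^+ (3 + m) = 8 * 2 ^+ m :> R /\ 2 ^+ (3 + m).+1 = 16 * 2 ^+ m :> R.
Proof.
have pow_m : 2 ^+ (3 + m) = 8 * 2 ^+ m :> R by rewrite exprD; ring.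
by split=> //; rewrite (exprS _ (3 + m)) pow_m; ring.
Qed.

Lemma psi_moments (R : realFieldType) n : (3 <= n)%N ->
  [/\ \sum_(1 <= j < n.+1) (psi j)%:R = 3 * 2 ^+ n / 8 :> R,
      \sum_(1 <= j < n.+1) j%:R * (psi j)%:R =
        3 * (n%:R - 1) * 2 ^+ n / 8 + 2 :> R
    & \sum_(1 <= j < n.+1) j%:R ^+ 2 * (psi j)%:R =
        3 * (n%:R ^+ 2 - 2 * n%:R + 3) * 2 ^+ n / 8 + 4 :> R].
Proof.
move=> /subnKC <-; elim: (n - 3)%N => [|m [IH0 IH1 IH2]].
  by rewrite addn0 /index_iota /= unlock /= psi1 psi2 psi3; split; field.
have psi_m : (psi (3 + m).+1)%:R = 3 * 2 ^+ m :> R.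
  by rewrite psi_geom natrM natrX.
have [pow_m pow_m1] := exp2_add3 R m.
rewrite addnS; split; rewrite big_nat_recr //= psi_m.
- by rewrite IH0 pow_m pow_m1; field.
- by rewrite IH1 pow_m pow_m1; field.
- by rewrite IH2 pow_m pow_m1; field.
Qed.

(** * Moments of the rows *)

Lemma weighted_row_sum_rec (R : pzRingType) (f : nat -> R) n : (0 < n)%N ->
  \sum_(1 <= j < n.+3) f j * (Tarr n.+1 j)%:~R =
    \sum_(1 <= j < n.+2) f j * (Tarr n j)%:~R
    + \sum_(1 <= j < n.+1) f j * (psi j)%:R
    + f n.+1 * ((Tarr n.+1 n.+1)%:~R - 1) + f n.+2.
Proof.
move=> n_gt0; rewrite [LHS]big_nat_recr //= [X in X + _]big_nat_recr //=.
rewrite [X in _ = X + _ + _ + _]big_nat_recr //= !Tarr_last !mulr1.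
have -> : \sum_(1 <= j < n.+1) f j * (Tarr n.+1 j)%:~R =
    \sum_(1 <= j < n.+1) f j * (Tarr n j)%:~R
    + \sum_(1 <= j < n.+1) f j * (psi j)%:R.
  rewrite -big_split /=; apply: eq_big_nat => j jn.
  by rewrite Tarr_rec // intrD mulrDr.
rewrite mulrBr mulr1; congr (_ + _).
rewrite -!addrA; congr (_ + _).
by rewrite [RHS]addrCA; congr (_ + _); rewrite addrC subrK.
Qed.

(** Rows 2 and 3 are both computed: the step from row 2 to row 3 involves
[T_(3,3)] and [psi 1 + psi 2], which do not follow the geometric closed forms,
so that the induction has to start at row 3. *)
Lemma row_moments (R : realFieldType) n : (2 <= n)%N ->
  [/\ \sum_(1 <= j < n.+2) (Tarr n j)%:~R = 2 ^+ n :> R,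
      \sum_(1 <= j < n.+2) j%:R * (Tarr n j)%:~R =
        (n%:R - 7 / 4) * 2 ^+ n + 3 * n%:R + 1 :> R
    & \sum_(1 <= j < n.+2) j%:R ^+ 2 * (Tarr n j)%:~R =
        (n%:R ^+ 2 - 7 * n%:R / 2 + 27 / 4) * 2 ^+ n
        + n%:R ^+ 2 + 6 * n%:R - 13 :> R].
Proof.
have T21 : Tarr 2 1 = 1 by [].
have T31 : Tarr 3 1 = 1 by [].
have T32 : Tarr 3 2 = 3 by [].
rewrite leq_eqVlt => /predU1P[<-|].
  by rewrite /index_iota /= unlock /= T21 Tarr22 Tarr_last; split; field.
move=> /subnKC <-; elim: (n - 3)%N => [|m [IH0 IH1 IH2]].
  rewrite addn0 /index_iota /= unlock /= T31 T32 Tarr33 Tarr_last.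
  by split; field.
have [S0 S1 S2] := @psi_moments R (3 + m) isT.
have diag_m : (Tarr (3 + m).+1 (3 + m).+1)%:~R = 5 * 2 ^+ m :> R.
  by rewrite Tarr_diag_geom intrM rmorphXn.
have [pow_m pow_m1] := exp2_add3 R m.
rewrite addnS; split.
- have := @weighted_row_sum_rec R (fun=> 1) (3 + m) isT.
  under eq_bigr do rewrite mul1r.
  under [X in _ = X + _ + _ + _ -> _]eq_bigr do rewrite mul1r.
  under [X in _ = _ + X + _ + _ -> _]eq_bigr do rewrite mul1r.
  by rewrite IH0 S0 diag_m pow_m pow_m1 => ->; field.
- rewrite (@weighted_row_sum_rec R (fun j => j%:R)) // IH1 S1 diag_m.
  by rewrite pow_m pow_m1; field.
- rewrite (@weighted_row_sum_rec R (fun j => j%:R ^+ 2)) // IH2 S2 diag_m.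
  by rewrite pow_m pow_m1; field.
Qed.

(** * Random variables with finitely many values *)

(** [g \o X] is the linear combination, with coefficients [g x], of the
indicators of the events [X = x], which are integrable. *)
Lemma expectation_finite_support (R : realType) (d : measure_display)
    (T : measurableType d) (P : probability T R) (X : {RV P >-> R})
    (s : seq R) (g : R -> R) :
  uniq s -> (forall t, X t \in s) ->
  ('E_P[g \o X] = \sum_(x <- s) (g x)%:E * P (X @^-1` [set x]))%E.
Proof.
move=> s_uniq Xs.
have mX x : measurable (X @^-1` [set x]) by exact: measurable_funPTI.
have -> : g \o X =
    \sum_(h <- [seq g x \o* \1_(X @^-1` [set x]) | x <- s]) h :> (T -> R).
  apply/funext => t; rewrite big_map fct_sumE (bigD1_seq (X t)) //=.
  rewrite indicE mem_set // mul1r big1 ?addr0 // => x xX.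
  by rewrite indicE memNset ?mul0r //=; apply/eqP; rewrite eq_sym.
have L1 x : (\1_(X @^-1` [set x]) : T -> R) \in Lfun P 1.
  by apply/Lfun1_integrable; exact: integrable_indic.
rewrite expectation_sum => [|h /mapP[x _ ->]]; last by rewrite Lfun_scale.
rewrite big_map; apply: eq_bigr => x _.
by rewrite expectationZl // expectation_indic.
Qed.

(** The variance is the expectation of [(x - m) ^+ 2] at [X], which is again a
function of [X], so that it is a finite sum too. *)
Lemma variance_finite_support (R : realType) (d : measure_display)
    (T : measurableType d) (P : probability T R) (X : {RV P >-> R})
    (s : seq R) (m : R) :
  uniq s -> (forall t, X t \in s) -> ('E_P[X] = m%:E)%E ->
  ('V_P[X] = \sum_(x <- s) ((x - m) ^+ 2)%:E * P (X @^-1` [set x]))%E.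
Proof.
move=> s_uniq Xs EX.
rewrite -(expectation_finite_support _ _ _ _ _ _ (fun x => (x - m) ^+ 2)) //.
by rewrite /variance unlock EX; congr ('E_P[_])%E.
Qed.

(** * Moments of the normalised rows *)

Theorem mainTheorem13 (R : realType) (d : measure_display)
    (T : measurableType d) (P : probability T R) (n : nat) (X : {RV P >-> R})
    (hn : (2 <= n)%N)
    (hX : forall t : T, exists2 j : nat, (1 <= j <= n.+1)%N & X t = j%:R)
    (hP : forall j : nat, (1 <= j <= n.+1)%N ->
            P (X @^-1` [set j%:R]) = (Tnorm R n j)%:E) :
  [/\ 'E_P[X] = (n%:R - 7 / 4 + (3 * n%:R + 1) / 2 ^+ n)%:E,
      'E_P[((X : T -> R) ^+ 2)%R] =
        (n%:R ^+ 2 - 7 * n%:R / 2 + 27 / 4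
         + (n%:R ^+ 2 + 6 * n%:R - 13) / 2 ^+ n)%:E
    & 'V_P[X] =
        (59 / 16 - (10 * n%:R ^+ 2 - 29 * n%:R + 19) / 2 ^+ n.+1
         - (9 * n%:R ^+ 2 + 6 * n%:R + 1) / 4 ^+ n)%:E]%E.
Proof.
pose s : seq R := [seq j%:R | j <- index_iota 1 n.+2].
have s_uniq : uniq s.
  by rewrite map_inj_uniq ?iota_uniq //; exact: mulrIn (oner_neq0 _).
have Xs t : X t \in s.
  by have [j jn ->] := hX t; apply: map_f; rewrite mem_index_iota ltnS.
have law (g : R -> R) : (\sum_(x <- s) (g x)%:E * P (X @^-1` [set x]) =
    (2 ^- n * \sum_(1 <= j < n.+2) g j%:R * (Tarr n j)%:~R)%:E)%E.
  rewrite big_map mulr_sumr -sumEFin; apply: eq_big_nat => j jn.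
  by rewrite hP // /Tnorm -EFinM mulrCA.
have expect g : ('E_P[g \o X] =
    (2 ^- n * \sum_(1 <= j < n.+2) g j%:R * (Tarr n j)%:~R)%:E)%E.
  by rewrite (expectation_finite_support _ _ _ P X s) // law.
have [M0 M1 M2] := @row_moments R n hn.
have pow2_neq0 : 2 ^+ n != 0 :> R by rewrite expf_neq0.
have EX : 'E_P[X]%E = (n%:R - 7 / 4 + (3 * n%:R + 1) / 2 ^+ n)%:E.
  by rewrite (expect id) M1; congr EFin; field.
split=> //.
  by rewrite (expect (fun x => x ^+ 2)) M2; congr EFin; field.
rewrite (variance_finite_support _ _ _ _ X s _ s_uniq Xs EX).
set m := (X in X%:E) in EX *.
rewrite (law (fun x => (x - m) ^+ 2)); congr EFin.
have -> : \sum_(1 <= j < n.+2) (j%:R - m) ^+ 2 * (Tarr n j)%:~R =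
    \sum_(1 <= j < n.+2) j%:R ^+ 2 * (Tarr n j)%:~R
    - 2 * m * (\sum_(1 <= j < n.+2) j%:R * (Tarr n j)%:~R)
    + m ^+ 2 * \sum_(1 <= j < n.+2) (Tarr n j)%:~R.
  by rewrite !mulr_sumr -sumrB -big_split /=; apply: eq_bigr => j _; ring.
(* This makes both sides rational functions of n and 2 ^+ n. *)
have -> : 4 ^+ n = (2 ^+ n) ^+ 2 :> R by rewrite exprAC; congr (_ ^+ n); ring.
by rewrite M0 M1 M2 /m (exprS _ n); field.
Qed.
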